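(* Let $n\ge 1$, let $Q$ be a real symmetric non-singular $(n+2)\times(n+2)$ matrix, let $c\neq 0$ be a real number, and let $\mathcal{Q}=\{x\in\mathbf{R}^{n+2} : x\cdot Qx=c\}$. Let $M$ be a compact smooth $n$-manifold (without boundary), and let $F:M\to\mathcal{Q}$ be a $C^1$ immersion. Then either $F$ is DA-regular, or else $F$ has a pair of parallel tangent planes.
   Context: Since $c\ne0$, $\mathcal{Q}$ is a smooth hypersurface in $\mathbf{R}^{n+2}$. Define the double-point locus $$D_F:=\{(p,q)\in M\times M : p\neq q,\ F(p)=F(q)\}$$ and the antipodal locus $$A_F:=\{(p,q)\in M\times M : F(p)=-F(q)\}.$$ The $C^1$ immersion $F:M\to\mathcal{Q}$ is called DA-regular if $D_F$ and $A_F$ are both embedded $(n-1)$-dimensional $C^1$ submanifolds of $M\times M$ (the empty set counts as such a submanifold). $F$ has a pair of parallel tangent planes if there are distinct points $p,q\in M$ with $dF(T_pM)=dF(T_qM)$ as linear subspaces of $\mathbf{R}^{n+2}$. *)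

(* Defs.v *)
From mathcomp Require Import all_boot all_order all_algebra.
From mathcomp Require Import all_classical all_reals all_analysis.
Import Order.TTheory GRing.Theory Num.Theory numFieldNormedType.Exports.

Set Implicit Arguments.
Unset Strict Implicit.
Unset Printing Implicit Defensive.

Local Open Scope classical_set_scope.
Local Open Scope ring_scope.

(** Points of R^m are row vectors, so [x . Qx] is [x *m Q *m x^T]. *)
Definition quadric (R : realType) (m : nat) (Q : 'M[R]_m) (c : R) :
    set 'rV[R]_m :=
  [set x | (x *m Q *m x^T) ord0 ord0 = c].

(** Class C^k on an open set [U] between finite-dimensional spaces, by
    recursion on the directional derivatives. At level k+1 full (Frechet)
    differentiability is required, so that e.g. C^1 means differentiable with
    continuous differential. Only meaningful for open [U]. *)
Fixpoint Ck (R : realType) (V W : normedModType R) (k : nat) (U : set V)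
    (f : V -> W) : Prop :=
  match k with
  | 0 => forall x, U x -> {for x, continuous f}
  | k'.+1 => (forall x, U x -> differentiable f x) /\
             (forall v : V, Ck k' U ('D_v f))
  end.

Definition Cinfty (R : realType) (V W : normedModType R) (U : set V)
    (f : V -> W) : Prop :=
  forall k, Ck k U f.

(** A chart is a partial map from [M] to R^m with a partial inverse; outside
    [chart_dom] and [chart_cod] the two total functions carry junk values. *)
Record chart (R : realType) (M : Type) (m : nat) := Chart {
  chart_dom : set M;
  chart_map :> M -> 'rV[R]_m;
  chart_inv : 'rV[R]_m -> M
}.

Definition chart_cod (R : realType) (M : Type) (m : nat) (phi : chart R M m) :
    set 'rV[R]_m :=
  phi @` chart_dom phi.

Definition is_chart (R : realType) (M : topologicalType) (m : nat)
    (phi : chart R M m) : Prop :=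
  [/\ open (chart_dom phi),
      open (chart_cod phi),
      (forall p, chart_dom phi p -> chart_inv phi (phi p) = p),
      (forall p, chart_dom phi p -> {for p, continuous phi}) &
      (forall x, chart_cod phi x -> {for x, continuous (chart_inv phi)})].

Definition overlap (R : realType) (M : Type) (m : nat)
    (phi psi : chart R M m) : set 'rV[R]_m :=
  phi @` (chart_dom phi `&` chart_dom psi).

Definition transition (R : realType) (M : Type) (m : nat)
    (phi psi : chart R M m) : 'rV[R]_m -> 'rV[R]_m :=
  psi \o chart_inv phi.

(** [A] is a (not necessarily maximal) C^oo atlas making [M] an
    [m]-dimensional smooth manifold without boundary. All notions below depend
    only on the smooth structure that [A] generates. *)
Definition smooth_manifold (R : realType) (M : topologicalType) (m : nat)
    (A : set (chart R M m)) : Prop :=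
  [/\ hausdorff_space M,
      @second_countable M,
      (forall phi, A phi -> is_chart phi),
      (forall p : M, exists2 phi, A phi & chart_dom phi p) &
      (forall phi psi, A phi -> A psi ->
         Cinfty (overlap phi psi) (transition phi psi))].

Definition prod_chart (R : realType) (M N : Type) (m n : nat)
    (phi : chart R M m) (psi : chart R N n) : chart R (M * N)%type (m + n) :=
  {| chart_dom := chart_dom phi `*` chart_dom psi;
     chart_map := fun z => row_mx (phi z.1) (psi z.2);
     chart_inv := fun x => (chart_inv phi (lsubmx x),
                            chart_inv psi (rsubmx x)) |}.

(** The product smooth structure. *)
Definition prod_atlas (R : realType) (M N : Type) (m n : nat)
    (A : set (chart R M m)) (B : set (chart R N n)) :
    set (chart R (M * N)%type (m + n)) :=
  [set chi | exists phi psi, [/\ A phi, B psi & chi = prod_chart phi psi]].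

(** A chart of the C^1 manifold underlying the atlas [A]. *)
Definition C1_chart (R : realType) (M : topologicalType) (m : nat)
    (A : set (chart R M m)) (phi : chart R M m) : Prop :=
  is_chart phi /\
  forall psi, A psi -> Ck 1 (overlap phi psi) (transition phi psi) /\
                       Ck 1 (overlap psi phi) (transition psi phi).

(** Embedded [k]-dimensional C^1 submanifold: around each point of [S] there is
    a C^1 chart of the ambient manifold in which [S] is the slice
    [x_k = ... = x_(m-1) = 0] (coordinates numbered from 0). *)
Definition embedded_C1_submanifold (R : realType) (M : topologicalType)
    (m : nat) (A : set (chart R M m)) (k : nat) (S : set M) : Prop :=
  forall p, S p -> exists phi : chart R M m,
    [/\ C1_chart A phi, chart_dom phi p &
        phi @` (S `&` chart_dom phi) =
        chart_cod phi `&`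
          [set x | forall i : 'I_m, (k <= i)%N -> x ord0 i = 0]].

Definition C1_map (R : realType) (M : topologicalType) (m d : nat)
    (A : set (chart R M m)) (F : M -> 'rV[R]_d) : Prop :=
  forall phi, A phi -> Ck 1 (chart_cod phi) (F \o chart_inv phi).

(** The differential of [F] at [p] read in the chart [phi]. A tangent vector at
    [p] is the class of a pair ([phi], [v]) with [phi] a chart at [p] and [v]
    in R^m, two pairs being identified through the Jacobian of the transition
    map; [dF] sends this class to [chart_diff F phi p v]. *)
Definition chart_diff (R : realType) (M : topologicalType) (m d : nat)
    (F : M -> 'rV[R]_d) (phi : chart R M m) (p : M) : 'rV[R]_m -> 'rV[R]_d :=
  'd (F \o chart_inv phi) (phi p).

Definition C1_immersion (R : realType) (M : topologicalType) (m d : nat)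
    (A : set (chart R M m)) (F : M -> 'rV[R]_d) : Prop :=
  C1_map A F /\
  forall phi p, A phi -> chart_dom phi p -> injective (chart_diff F phi p).

(** The linear subspace [dF(T_pM)]; every chart at [p] contributes the same
    range to the union. *)
Definition tangent_plane (R : realType) (M : topologicalType) (m d : nat)
    (A : set (chart R M m)) (F : M -> 'rV[R]_d) (p : M) : set 'rV[R]_d :=
  \bigcup_(phi in [set phi | A phi /\ chart_dom phi p])
    range (chart_diff F phi p).

Definition double_point_locus (R : realType) (M : Type) (d : nat)
    (F : M -> 'rV[R]_d) : set (M * M)%type :=
  [set z | z.1 <> z.2 /\ F z.1 = F z.2].

Definition antipodal_locus (R : realType) (M : Type) (d : nat)
    (F : M -> 'rV[R]_d) : set (M * M)%type :=
  [set z | F z.1 = - F z.2].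

(** [n.-1] is the genuine [n - 1] only for [n >= 1]. *)
Definition DA_regular (R : realType) (M : topologicalType) (n d : nat)
    (A : set (chart R M n)) (F : M -> 'rV[R]_d) : Prop :=
  embedded_C1_submanifold (prod_atlas A A) n.-1 (double_point_locus F) /\
  embedded_C1_submanifold (prod_atlas A A) n.-1 (antipodal_locus F).

Definition has_parallel_tangent_planes (R : realType) (M : topologicalType)
    (n d : nat) (A : set (chart R M n)) (F : M -> 'rV[R]_d) : Prop :=
  exists p q : M, p <> q /\ tangent_plane A F p = tangent_plane A F q.

(* Main.v *)
(* Assume that distinct points have distinct tangent planes. At a pair (p, q) of
   distinct points with F p = e F q, e = 1 or -1, both planes lie in the
   hyperplane orthogonal to Q x0, where x0 = F p; being distinct, they span it.
   So G(u, v) = F u - e F v has a differential of rank n + 1 at (p, q), whose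
   image does not contain x0 because x0 . Q x0 = c <> 0. Composing G with the
   projection along x0 and completing it by n - 1 linear coordinates gives a C^1
   local diffeomorphism, by the inverse function theorem; in these coordinates
   the slice is the set where G is a multiple of x0. Near (p, q) this forces
   G = 0: as F u and e F v lie on the quadric, (F u + e F v) . Q G(u, v) = 0,
   whereas (F u + e F v) . Q x0 is close to 2c. *)
Require Import Defs.
From mathcomp Require Import all_boot all_order all_algebra all_fingroup.
From mathcomp Require Import all_classical all_reals all_analysis.
From mathcomp Require Import zify ring lra.
Import Order.TTheory GRing.Theory Num.Theory numFieldNormedType.Exports.

Set Implicit Arguments.
Unset Strict Implicit.
Unset Printing Implicit Defensive.

Local Open Scope classical_set_scope.
Local Open Scope ring_scope.

(** * C^1 maps on row vectors *)

(** [g] inherits the first-order expansion of [f] at [a], and uniqueness of the differential turns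
    that expansion into differentiability. *)
Lemma near_eq_differentiable (R : realType) (V W : normedModType R)
    (f g : V -> W) (a : V) :
  (\near a, f a = g a) -> differentiable f a -> differentiable g a.
Proof.
move=> fg df.
have ga := nbhs_singleton fg.
suff E : g \o shift a = cst (g a) + 'd f a +o_ 0 id.
  have dgf : 'd g a = 'd f a :> (V -> W).
    by apply: diff_unique => //; exact: diff_continuous.
  apply/diff_locallyP; split; first by rewrite dgf; exact: diff_continuous.
  by rewrite dgf.
apply/eqaddoP => e e0; rewrite -ga.
move/eqaddoP : (diff_locally df) => /(_ e e0).
apply: filter_app; move: fg; rewrite (near_shift 0 a) subr0 /=.
by apply: filter_app; near=> x; rewrite /= !fctE /= => ->.
Unshelve. all: by end_near. Qed.

Lemma near_eq_continuous (T S : topologicalType) (f g : T -> S) (x : T) :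
  (\near x, f x = g x) -> {for x, continuous f} -> {for x, continuous g}.
Proof.
move=> fg cf; change (g @ x --> g x); rewrite -(nbhs_singleton fg).
exact: cvg_trans (near_eq_cvg fg) cf.
Qed.

Lemma open_near (T : topologicalType) (U : set T) (P : T -> Prop) (x : T) :
  open U -> U x -> (forall y, U y -> P y) -> \near x, P x.
Proof. by move=> oU Ux UP; apply: filterS UP _; exact: open_nbhs_nbhs. Qed.

Lemma Ck1_eq_on (R : realType) (V W : normedModType R) (U : set V)
    (f g : V -> W) : open U -> (forall x, U x -> f x = g x) ->
  Ck 1 U f -> Ck 1 U g.
Proof.
move=> oU fg [df cf].
have nfg x : U x -> \near x, f x = g x.
  by move=> Ux; exact: open_near oU Ux fg.
split=> [x Ux|v x Ux]; first exact: near_eq_differentiable (nfg x Ux) (df x Ux).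
have E y : U y -> 'D_v f y = 'D_v g y by move=> Uy; exact: near_eq_derive (nfg y Uy).
exact: near_eq_continuous (open_near oU Ux E) (cf v x Ux).
Qed.

Lemma continuous_sum (R : realType) (T : topologicalType)
    (W : normedModType R) (I : Type) (r : seq I) (f : I -> T -> W) (x : T) :
  (forall i, {for x, continuous (f i)}) ->
  {for x, continuous (fun y => \sum_(i <- r) f i y)}.
Proof.
move=> cf; elim: r => [|i r IH].
  rewrite (_ : (fun _ => _) = cst 0); first exact: cst_continuous.
  by apply/funext => y; rewrite big_nil.
rewrite (_ : (fun _ => _) = fun y => f i y + \sum_(j <- r) f j y); last first.
  by apply/funext => y; rewrite big_cons.
exact: cvgD (cf i) IH.
Qed.

Lemma linear_rV_expand (R : realType) (W : normedModType R) (m : nat)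
    (f : {linear 'rV[R]_m -> W}) v : f v = \sum_j v ord0 j *: f (delta_mx ord0 j).
Proof.
rewrite [v in LHS]row_sum_delta linear_sum; apply: eq_bigr => j _.
by rewrite linearZ.
Qed.

Lemma linear_rV_continuous (R : realType) (W : normedModType R) (m : nat)
    (f : {linear 'rV[R]_m -> W}) : continuous f.
Proof.
move=> v; rewrite (_ : (f : _ -> _) = fun u => \sum_j u ord0 j *: f (delta_mx ord0 j)).
  apply: continuous_sum => j; apply: continuousZ; last exact: cst_continuous.
  exact: (@coord_continuous R 1 m ord0 j v).
by apply/funext => u; exact: linear_rV_expand.
Qed.

Lemma is_diff_linear_rV (R : realType) (W : normedModType R) (m : nat)
    (f : {linear 'rV[R]_m -> W}) x : is_diff x f f.
Proof.
apply: DiffDef; last by apply: diff_lin; exact: linear_rV_continuous.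
by apply: linear_differentiable; exact: linear_rV_continuous.
Qed.

Lemma diff_rV_expand (R : realType) (W : normedModType R) (m : nat)
    (f : 'rV[R]_m -> W) x v : differentiable f x ->
  'd f x v = \sum_j v ord0 j *: 'D_(delta_mx ord0 j) f x.
Proof.
move=> df; apply: etrans (linear_rV_expand ('d f x) v) _.
by apply: eq_bigr => j _; rewrite [in RHS]deriveE.
Qed.

Lemma Ck1_linear (R : realType) (W : normedModType R) (m : nat)
    (f : {linear 'rV[R]_m -> W}) (U : set 'rV[R]_m) : Ck 1 U f.
Proof.
have df x : differentiable f x.
  by apply: linear_differentiable; exact: linear_rV_continuous.
split=> // v x _.
rewrite (_ : 'D_v f = cst (f v)); first exact: cst_continuous.
apply/funext => y; rewrite deriveE // diff_lin //; exact: linear_rV_continuous.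
Qed.

Lemma Ck1_add (R : realType) (V W : normedModType R) (U : set V)
    (f g : V -> W) : open U -> Ck 1 U f -> Ck 1 U g -> Ck 1 U (fun x => f x + g x).
Proof.
move=> oU [df cf] [dg cg].
split=> [x Ux|v x Ux]; first exact: differentiableD (df x Ux) (dg x Ux).
have E y : U y -> 'D_v f y + 'D_v g y = 'D_v (fun x => f x + g x) y.
  by move=> Uy; rewrite [RHS]deriveD //; apply: diff_derivable; [exact: df|exact: dg].
apply: near_eq_continuous (open_near oU Ux E) _.
exact: cvgD (cf v x Ux) (cg v x Ux).
Qed.

Lemma Ck1_continuous (R : realType) (V W : normedModType R) (U : set V)
    (f : V -> W) x : Ck 1 U f -> U x -> {for x, continuous f}.
Proof. by move=> [df _] Ux; apply: differentiable_continuous; exact: df. Qed.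

(** The chain rule writes ['D_v (g \o f)] as a finite sum of partial derivatives of [g] along [f],
    weighted by the coordinates of ['D_v f]. Finite dimension of the middle space matters: [Ck]
    gives continuity of the derivative in each fixed direction only, whereas the direction
    ['D_v f y] moves with [y]. *)
Lemma Ck1_comp (R : realType) (V W : normedModType R) (n : nat)
    (U : set V) (U' : set 'rV[R]_n) (f : V -> 'rV[R]_n) (g : 'rV[R]_n -> W) :
  open U -> (forall x, U x -> U' (f x)) -> Ck 1 U f -> Ck 1 U' g ->
  Ck 1 U (g \o f).
Proof.
move=> oU UU' cf [dg cg]; have [df cdf] := cf.
split=> [x Ux|v x Ux].
  by apply: differentiable_comp; [exact: df|apply: dg; exact: UU'].
have E y : U y ->
    \sum_j ('D_v f y) ord0 j *: 'D_(delta_mx ord0 j) g (f y) = 'D_v (g \o f) y.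
  move=> Uy; have dgy := dg _ (UU' _ Uy); have dfy := df _ Uy.
  rewrite [RHS]deriveE; last exact: differentiable_comp.
  by rewrite [in RHS]diff_comp //= -(deriveE v dfy) diff_rV_expand.
apply: near_eq_continuous (open_near oU Ux E) _.
apply: continuous_sum => j; apply: continuousZ.
  apply: (@continuous_comp _ _ _ ('D_v f) (fun M : 'rV[R]_n => M ord0 j)).
    exact: cdf.
  exact: (@coord_continuous R 1 n ord0 j).
apply: (@continuous_comp _ _ _ f ('D_(delta_mx ord0 j) g)).
  exact: Ck1_continuous cf Ux.
by apply: cg; exact: UU'.
Qed.

Lemma Ck1_subset (R : realType) (V W : normedModType R) (U U' : set V)
    (f : V -> W) : U' `<=` U -> Ck 1 U f -> Ck 1 U' f.
Proof. by move=> s [df cf]; split=> [x /s /df|v x /s /(cf v)]. Qed.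

Lemma Ck1_mulmxr (R : realType) (V : normedModType R) p q (U : set V)
    (f : V -> 'rV[R]_p) (B : 'M[R]_(p, q)) :
  open U -> Ck 1 U f -> Ck 1 U (fun x => f x *m B).
Proof.
move=> oU cf; apply: (@Ck1_comp _ _ _ _ _ setT f (mulmxr B)) => //.
exact: Ck1_linear.
Qed.

Lemma continuous_mulmxr (R : realType) (T : topologicalType) p q
    (f : T -> 'rV[R]_p) (B : 'M[R]_(p, q)) x :
  {for x, continuous f} -> {for x, continuous (fun y => f y *m B)}.
Proof.
move=> cf; apply: (@continuous_comp _ _ _ f (mulmxr B)); first exact: cf.
exact: linear_rV_continuous.
Qed.

(** * The inverse function theorem *)

Lemma mx_norm_le (R : realType) m n (x : 'M[R]_(m, n)) (k : R) :
  0 <= k -> (forall i j, `|x i j| <= k) -> `|x| <= k.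
Proof.
move=> k0 xk; rewrite [leLHS]/Num.Def.normr/= mx_normrE.
by apply: bigmax_le => // -[i j] _.
Qed.

Lemma mx_coord_le_norm (R : realType) m n (x : 'M[R]_(m, n)) i j :
  `|x i j| <= `|x|.
Proof.
rewrite [leRHS]/Num.Def.normr/= mx_normrE.
exact: (le_bigmax _ (fun ij => `|x ij.1 ij.2|) (i, j)).
Qed.

(** The norm is the maximum of the coordinates, so the one-variable mean value theorem can be
    applied to each coordinate along the segment, with an intermediate point that may depend on the
    coordinate. *)
Lemma rV_mean_value (R : realType) m n (G : 'rV[R]_m -> 'rV[R]_n) x y (K : R) :
  (forall t : R, 0 <= t <= 1 -> differentiable G (t *: (y - x) + x)) ->
  (forall t : R, 0 <= t <= 1 -> `|'d G (t *: (y - x) + x) (y - x)| <= K) ->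
  `|G y - G x| <= K.
Proof.
set w := y - x => dG bG.
have K0 : 0 <= K by apply: le_trans (bG 0 _) => //; rewrite lexx ler01.
apply: mx_norm_le => // i j.
pose M := fun t : R => G (t *: w + x).
have dM (t : R) : 0 <= t <= 1 -> is_diff t M ('d G (t *: w + x) \o ( *:%R^~ w)).
  move=> t01; pose gam := fun t : R => t *: w + x.
  have dgam : is_diff t gam ( *:%R^~ w).
    apply: is_diff_eq (_ : is_diff t ((fun t : R => t *: w) + cst x) ( *:%R^~ w + 0)) _.
    by rewrite addr0.
  apply: (@is_diff_comp _ _ _ _ gam _ G) => //.
  by apply: differentiableP; exact: dG.
have der (t : R) : 0 <= t <= 1 -> is_derive t 1 (fun t => M t i j)
    (('d G (t *: w + x) w) i j).
  move=> /[dup] t01 /dM dMt.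
  have dfM : derivable M t 1 by apply: diff_derivable; exact: ex_diff.
  apply: DeriveDef; first by move/derivable_mxP : dfM.
  have := derive_mx dfM; rewrite deriveE; last exact: ex_diff.
  rewrite diff_val /= scale1r => ->; by rewrite mxE.
have [||c c01 E] := @MVT R (fun t => M t i j)
  (fun t => ('d G (t *: w + x) w) i j) 0 1 ltr01.
- by move=> t; rewrite in_itv /= => /andP[t0 t1]; apply: der; rewrite !ltW.
- apply: derivable_within_continuous => t; rewrite in_itv /= => /der dt.
  exact: ex_derive.
move: E; rewrite /M scale1r scale0r add0r subr0 mulr1 /w subrK => E.
rewrite !mxE E; apply: le_trans (mx_coord_le_norm _ _ _) _.
by apply: bG; move: c01; rewrite in_itv /= => /andP[? ?]; rewrite !ltW.
Qed.

Lemma near_closed_ball (R : realType) (V : normedModType R) (a : V)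
    (P : V -> Prop) :
  (\near a, P a) <-> exists2 r, 0 < r & forall x, `|x - a| <= r -> P x.
Proof.
split=> [/nbhs_normP[e /= e0 eP]|[r r0 rP]].
  exists (e / 2) => [|x xa]; first by rewrite divr_gt0.
  apply: eP; rewrite /= distrC (le_lt_trans xa) //.
  by rewrite ltr_pdivrMr // ltr_pMr // ltr1n.
by apply/nbhs_normP; exists r => // x /= ax; apply: rP; rewrite distrC ltW.
Qed.

(** The differential is a combination of finitely many continuous partial derivatives, hence is
    close to ['d f a] uniformly on a small ball. The mean value inequality for [f] minus its linear
    part at [a] then gives the last estimate, balls being convex. *)
Lemma C1_strict_differentiable (R : realType) m n (U : set 'rV[R]_m)
    (f : 'rV[R]_m -> 'rV[R]_n) a (e : R) :
  open U -> U a -> Ck 1 U f -> 0 < e ->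
  exists2 r, 0 < r & [/\ (forall x, `|x - a| <= r -> U x),
    (forall x v, `|x - a| <= r -> `|'d f x v - 'd f a v| <= e * `|v|) &
    (forall x y, `|x - a| <= r -> `|y - a| <= r ->
       `|f y - f x - 'd f a (y - x)| <= e * `|y - x|)].
Proof.
(* The tolerance is shared among the [m] partial derivatives; dividing by [m.+1] also covers
   [m = 0]. *)
move=> oU Ua [df cf] e0; pose d := e / m.+1%:R.
have d0 : 0 < d by rewrite divr_gt0.
have nU : \forall x \near a, U x by exact: open_near oU Ua _.
have nd : \forall x \near a,
    forall j, `|'D_(delta_mx ord0 j) f a - 'D_(delta_mx ord0 j) f x| <= d.
  apply: (@filter_forall _ 'I_m (fun j x =>
    `|'D_(delta_mx ord0 j) f a - 'D_(delta_mx ord0 j) f x| <= d)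
    (nbhs a) (nbhs_filter a)) => j.
  have cj : 'D_(delta_mx ord0 j) f @ a --> 'D_(delta_mx ord0 j) f a.
    exact: cf.
  by move: cj => /cvgrPdist_le /(_ _ d0).
have [r r0 rP] := (@near_closed_ball R 'rV[R]_m a _).1 (filterI nU nd).
have rU x : `|x - a| <= r -> U x by move=> /rP[].
have rd x v : `|x - a| <= r -> `|'d f x v - 'd f a v| <= e * `|v|.
  move=> xr; have [Ux dx] := rP x xr.
  have Ex := diff_rV_expand v (df x Ux).
  have Ea := diff_rV_expand v (df a Ua).
  have {Ex Ea}-> : 'd f x v - 'd f a v =
      \sum_j v ord0 j *: ('D_(delta_mx ord0 j) f x - 'D_(delta_mx ord0 j) f a).
    apply: etrans (congr2 (fun p q => p - q) Ex Ea) _.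
    by rewrite -sumrB; apply: eq_bigr => j _; rewrite scalerBr.
  apply: le_trans (ler_norm_sum _ _ _) _.
  apply: (@le_trans _ _ (\sum_(j < m) (d * `|v|))).
    apply: ler_sum => j _; rewrite normrZ mulrC.
    by rewrite ler_pM // ?mx_coord_le_norm // distrC.
  rewrite sumr_const card_ord -mulrnAl ler_wpM2r //.
  rewrite /d -mulr_natr mulrAC ler_pdivrMr // ler_pM2l // ler_nat.
  exact: leqnSn.
exists r => //; split=> // x y xr yr.
pose G z := f z - 'd f a z.
have dG z : `|z - a| <= r -> is_diff z G
    (('d f z : 'rV[R]_m -> 'rV[R]_n) - ('d f a : 'rV[R]_m -> 'rV[R]_n)).
  move=> zr; have dfz := differentiableP (df z (rU _ zr)).
  have dda : is_diff z ('d f a) ('d f a) by exact: is_diff_linear_rV.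
  exact: is_diffB dfz dda.
have seg (t : R) : 0 <= t <= 1 -> `|t *: (y - x) + x - a| <= r.
  move=> /andP[t0 t1].
  rewrite (_ : _ - a = t *: (y - a) + (1 - t) *: (x - a)); last first.
    by apply/rowP => k; rewrite !mxE; ring.
  apply: le_trans (ler_normD _ _) _.
  rewrite !normrZ !ger0_norm ?subr_ge0 // [leRHS](_ : r = t * r + (1 - t) * r).
    by rewrite lerD // ler_wpM2l ?subr_ge0.
  by rewrite -mulrDl subrKC mul1r.
have -> : f y - f x - 'd f a (y - x) = G y - G x.
  by rewrite /G linearB /=; apply/rowP => k; rewrite !mxE; ring.
apply: rV_mean_value => t /seg tr; have ddG := dG _ tr; first exact: ex_diff.
by rewrite diff_val; exact: rd.
Qed.

Lemma continuous_for_normP (R : realType) (T : topologicalType)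
    (W : normedModType R) (f : T -> W) (x : T) :
  {for x, continuous f} <->
  forall e, 0 < e -> \forall y \near x, `|f x - f y| <= e.
Proof. by split=> [/cvgrPdist_le|h]; last apply/cvgrPdist_le. Qed.

Lemma diff_of_approx (R : realType) (V W : normedModType R)
    (g : V -> W) (L : {linear V -> W}) (a : V) : continuous L ->
  (forall e, 0 < e -> \forall x \near a, `|g x - g a - L (x - a)| <= e * `|x - a|) ->
  differentiable g a /\ 'd g a = L :> (V -> W).
Proof.
move=> cL approx.
have E : g \o shift a = cst (g a) + L +o_ 0 id.
  apply/eqaddoP => e e0.
  have := approx e e0; rewrite (near_shift 0 a) subr0 /=.
  apply: filter_app; near=> x => /=.
  by rewrite !fctE /= addrK opprD addrA.
have dgL : 'd g a = L :> (V -> W) by exact: diff_unique.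
by split=> //; apply/diff_locallyP; rewrite dgL.
Unshelve. all: by end_near. Qed.

(** The hypotheses give [|v| <= K * |u| + |v| / 2], and the last term is absorbed on the left. *)
Lemma lower_bound_perturbation (R : realType) m (K : R) (J : 'M[R]_m)
    (u v : 'rV[R]_m) : 0 < K ->
  `|v| <= K * `|v *m J| -> `|u - v *m J| <= (2 * K)^-1 * `|v| ->
  `|v| <= 2 * K * `|u|.
Proof.
move=> K0 h1 h2.
have h3 : `|v *m J| <= `|u| + (2 * K)^-1 * `|v|.
  rewrite -[v *m J](subKr u).
  by apply: le_trans (ler_normB _ _) _; rewrite lerD2l.
have h4 : `|v| <= K * `|u| + K * (2 * K)^-1 * `|v|.
  by apply: le_trans h1 _; rewrite -mulrA -mulrDr ler_pM2l.
have E : K * (2 * K)^-1 = 2^-1 by field; rewrite gt_eqF.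
rewrite E in h4; lra.
Qed.

(** This yields both injectivity of [f] near [a] and a Lipschitz bound for its inverse. *)
Lemma lipschitz_approx_expansive (R : realType) m (K r : R)
    (f : 'rV[R]_m -> 'rV[R]_m) a (J : 'M[R]_m) : 0 < K ->
  (forall v : 'rV[R]_m, `|v| <= K * `|v *m J|) ->
  (forall x y, `|x - a| <= r -> `|y - a| <= r ->
     `|f y - f x - (y - x) *m J| <= (2 * K)^-1 * `|y - x|) ->
  forall x y, `|x - a| <= r -> `|y - a| <= r -> `|y - x| <= 2 * K * `|f y - f x|.
Proof.
move=> K0 hK hf x y xr yr.
exact: lower_bound_perturbation K0 (hK _) (hf x y xr yr).
Qed.

(* A minimiser of |f c - y| on the closed ball must satisfy f c = y: otherwise
   the Newton step c + (y - f c) J^-1 stays in the ball and halves the error. *)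
Lemma lipschitz_approx_open_map (R : realType) m (K s : R)
    (f : 'rV[R]_m -> 'rV[R]_m) a (J : 'M[R]_m) : 0 < K -> 0 < s ->
  J \in unitmx ->
  (forall v : 'rV[R]_m, `|v| <= K * `|v *m J|) ->
  (forall x y, `|x - a| <= s -> `|y - a| <= s ->
     `|f y - f x - (y - x) *m J| <= (2 * K)^-1 * `|y - x|) ->
  (forall x, `|x - a| <= s -> {for x, continuous f}) ->
  forall y, `|y - f a| <= s / (8 * K) -> exists2 x, `|x - a| <= s & f x = y.
Proof.
move=> K0 s0 uJ hK hf cf y ys.
have ex := lipschitz_approx_expansive K0 hK hf.
pose B := [set x : 'rV[R]_m | `|x - a| <= s].
have aB : B a by rewrite /B/= subrr normr0 ltW.
have cB : compact B.
  have -> : B = closed_ball a s.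
    rewrite closed_ballE //; apply/seteqP; split=> x;
    by rewrite /B /closed_ball_ /= distrC.
  apply: bounded_closed_compact; last exact: closed_ball_closed.
  exists (`|a| + s); split; first by rewrite num_real.
  move=> M Ms x; rewrite closed_ballE // /closed_ball_ /= => xs.
  apply: le_trans (ltW Ms); rewrite -[x](subKr a).
  by apply: le_trans (ler_normB _ _) _; rewrite lerD2l.
have [|c cBc minc] := @EVT_min_rV R m (fun x => `|f x - y|) B (ex_intro _ a aB) cB.
  apply: continuous_in_subspaceT => x; rewrite inE => xs.
  apply: (@continuous_comp _ _ _ (fun x => f x - y) Num.norm).
    by apply: continuousB; [exact: cf|exact: cst_continuous].
  exact: norm_continuous.
rewrite inE /B /= in cBc.
exists c => //; apply/eqP; rewrite -subr_eq0 -normr_eq0; apply/eqP.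
have mca : `|f c - y| <= `|f a - y| by apply: minc; rewrite inE.
(* Expansiveness puts the minimiser [c] within [4 * K * d] of [a], and the Newton step moves it by
   at most [K * d]; as [s = 8 * K * d], the new point stays in the ball. *)
pose d := s / (8 * K).
have sd : s = 8 * (K * d).
  by rewrite /d; field; rewrite gt_eqF.
have ya : `|f a - y| <= d by rewrite distrC.
have aa : `|a - a| <= s by rewrite subrr normr0 ltW.
have ca : `|c - a| <= 2 * K * (2 * d).
  apply: le_trans (ex a c aa cBc) _; rewrite ler_pM2l ?mulr_gt0 //.
  rewrite -(subrK y (f c)) -addrA; apply: le_trans (ler_normD _ _) _.
  by rewrite (distrC y) mulr2n mulrDl mul1r lerD // (le_trans mca).
pose x1 := c + (y - f c) *m invmx J.
have x1c : (x1 - c) *m J = y - f c.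
  by rewrite /x1 addrC addKr mulmxKV.
have n1 : `|x1 - c| <= K * `|f c - y|.
  by apply: le_trans (hK _) _; rewrite x1c distrC.
have x1s : `|x1 - a| <= s.
  rewrite -(subrK c x1) -addrA; apply: le_trans (ler_normD _ _) _.
  have : K * `|f c - y| <= K * d by rewrite ler_pM2l // (le_trans mca).
  lra.
have := minc x1; rewrite inE => /(_ x1s) m1.
have := hf c x1 cBc x1s; rewrite x1c.
rewrite (_ : f x1 - f c - (y - f c) = f x1 - y); last first.
  by apply/rowP => k; rewrite !mxE; ring.
move=> h2.
have : (2 * K)^-1 * `|x1 - c| <= 2^-1 * `|f c - y|.
  apply: (@le_trans _ _ ((2 * K)^-1 * (K * `|f c - y|))).
    by rewrite ler_pM2l // invr_gt0 mulr_gt0.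
  by rewrite mulrA invfM -(mulrA _ K^-1) mulVf ?mulr1 ?gt_eqF.
have := normr_ge0 (f c - y); lra.
Qed.

Lemma invertible_lower_bound (R : realType) m (J : 'M[R]_m) : J \in unitmx ->
  exists2 K, 0 < K & forall v : 'rV[R]_m, `|v| <= K * `|v *m J|.
Proof.
move=> uJ.
have [K K0 hK] := linear_lipschitz (@linear_rV_continuous R _ m (mulmxr (invmx J))).
by exists K => // v; have := hK (v *m J); rewrite /= mulmxK.
Qed.

(** On a small ball [V] the map differs from [J] by a Lipschitz error of constant [(2 * K)^-1].
    Expansiveness then provides a Lipschitz inverse, and local surjectivity around each point of [V]
    makes the image open. The differential of the inverse is the inverse Jacobian, and its
    continuity follows from a lower bound for ['d f] that is uniform on [V]. *)
Lemma inverse_function (R : realType) m (U : set 'rV[R]_m)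
    (f : 'rV[R]_m -> 'rV[R]_m) (a : 'rV[R]_m) (J : 'M[R]_m) :
  open U -> U a -> Ck 1 U f -> (forall v, 'd f a v = v *m J) -> J \in unitmx ->
  exists V g, [/\ open V /\ V a, V `<=` U, open (f @` V),
    (forall x, V x -> g (f x) = x) & Ck 1 (f @` V) g].
Proof.
move=> oU Ua cf dfa uJ.
have [K K0 hK] := invertible_lower_bound uJ.
have K20 : 0 < 2 * K by rewrite mulr_gt0.
have [r r0 [rU rd rs]] : exists2 r, 0 < r & [/\ (forall x, `|x - a| <= r -> U x),
    (forall x v, `|x - a| <= r -> `|'d f x v - v *m J| <= (2 * K)^-1 * `|v|) &
    (forall x y, `|x - a| <= r -> `|y - a| <= r ->
       `|f y - f x - (y - x) *m J| <= (2 * K)^-1 * `|y - x|)].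
  have [|r r0 [h1 h2 h3]] := @C1_strict_differentiable R m m U f a (2 * K)^-1 oU Ua cf.
    by rewrite invr_gt0.
  by exists r => //; split=> // [x v|x y]; rewrite -dfa; [exact: h2|exact: h3].
have lip := lipschitz_approx_expansive K0 hK rs.
pose V := [set x : 'rV[R]_m | `|x - a| < r].
have Vr x : V x -> `|x - a| <= r by exact: ltW.
have oV : open V.
  rewrite (_ : V = ball a r); first exact: ball_open.
  by rewrite -ball_normE; apply/seteqP; split=> x; rewrite /V /= distrC.
have Va : V a by rewrite /V/= subrr normr0.
(* Outside the image of [V] the inverse takes the default value [a]. *)
pose g y := xget a [set x | V x /\ f x = y].
have gV y : (f @` V) y -> V (g y) /\ f (g y) = y.
  move=> [x Vx fx]; have [] // := @xgetPex _ a [set x | V x /\ f x = y].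
  by exists x.
have gf x : V x -> g (f x) = x.
  move=> Vx; have [|Vg fg] := gV (f x); first by exists x.
  apply/eqP; rewrite -subr_eq0 -normr_le0.
  apply: le_trans (lip x (g (f x)) (Vr _ Vx) (Vr _ Vg)) _.
  by rewrite fg subrr normr0 mulr0.
have cfx x : V x -> {for x, continuous f}.
  by move=> Vx; apply: Ck1_continuous cf _; exact/rU/Vr.
have ofV : open (f @` V).
  rewrite openE => _ [x Vx <-].
  have [s s0 sV] := (@near_closed_ball R 'rV[R]_m x V).1
    (open_near oV Vx (fun y Vy => Vy)).
  apply/(@near_closed_ball R 'rV[R]_m (f x)).
  exists (s / (8 * K)); first by rewrite divr_gt0 // mulr_gt0.
  move=> y ys.
  (* The matrix [J] taken at [a] serves at every [x] of [V], since the approximation [rs] holds on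
     the whole ball. *)
  have [||z zs fz] := @lipschitz_approx_open_map R m K s f x J K0 s0 uJ hK _ _ y ys.
  - by move=> z1 z2 /sV/Vr ? /sV/Vr ?; exact: rs.
  - by move=> z /sV; exact: cfx.
  by exists z => //; exact: sV.
(* This bound makes every Jacobian on [V] injective, with a constant independent of the point. *)
have dinv x v : V x -> `|v| <= 2 * K * `|'d f x v|.
  by move=> Vx; exact: lower_bound_perturbation K0 (hK v) (rd x v (Vr _ Vx)).
pose Jx x := lin1_mx ('d f x).
have JxE x v : v *m Jx x = 'd f x v by exact: mul_rV_lin1.
have uJx x : V x -> Jx x \in unitmx.
  move=> Vx; rewrite -row_free_unit -kermx_eq0; apply/eqP/row_matrixP => i.
  rewrite row0; apply/eqP; rewrite -normr_le0.
  apply: le_trans (dinv x _ Vx) _.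
  by rewrite -JxE -row_mul mulmx_ker row0 normr0 mulr0.
have glip y y0 : (f @` V) y -> (f @` V) y0 -> `|g y - g y0| <= 2 * K * `|y - y0|.
  move=> /gV[V1 E1] /gV[V0 E0].
  by rewrite -{2}E1 -{2}E0; apply: lip; exact: Vr.
have nV y0 : (f @` V) y0 -> \forall y \near y0, (f @` V) y.
  by move=> Vy; exact: open_near ofV Vy (fun y Vy => Vy).
have gcont y0 : (f @` V) y0 -> {for y0, continuous g}.
  move=> Vy0; apply/continuous_for_normP => e e0.
  have := nV y0 Vy0; apply: filter_app.
  apply/(@near_closed_ball R 'rV[R]_m y0); exists (e / (2 * K)).
    by rewrite divr_gt0.
  move=> y ye Vy; rewrite distrC; apply: le_trans (glip _ _ Vy Vy0) _.
  by rewrite -ler_pdivlMl // mulrC.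
have gdiff y0 : (f @` V) y0 -> differentiable g y0 /\
    'd g y0 = mulmxr (invmx (Jx (g y0))) :> ('rV[R]_m -> 'rV[R]_m).
  move=> Vy0; have [Vx0 fx0] := gV _ Vy0; set x0 := g y0 in Vx0 fx0 *.
  apply: diff_of_approx; first exact: linear_rV_continuous.
  move=> e e0.
  have [K' K'0 hK'] :=
    linear_lipschitz (@linear_rV_continuous R _ m (mulmxr (invmx (Jx x0)))).
  have cfV : Ck 1 V f by apply: Ck1_subset cf => x /Vr/rU.
  (* The tolerance anticipates the two factors lost below: [K'] from the inverse Jacobian at [x0]
     and [2 * K] from the Lipschitz bound on [g]. *)
  have [|s s0 [_ _ hs]] :=
    @C1_strict_differentiable R m m V f x0 (e / (K' * (2 * K))) oV Vx0 cfV.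
    by rewrite divr_gt0 // mulr_gt0.
  have := nV y0 Vy0; apply: filter_app.
  apply/(@near_closed_ball R 'rV[R]_m y0); exists (s / (2 * K)).
    by rewrite divr_gt0.
  move=> y ys Vy; have [Vx fx] := gV _ Vy.
  have xx0 := glip _ _ Vy Vy0.
  have xs : `|g y - x0| <= s.
    by apply: le_trans xx0 _; rewrite -ler_pdivlMl // mulrC.
  have h := hs x0 (g y) _ xs; rewrite subrr normr0 ltW // fx fx0 in h.
  have {}h := h isT.
  (* The linearisation error of [g] is minus that of [f], carried over by the inverse Jacobian. *)
  rewrite (_ : _ - _ = - ((y - y0 - 'd f x0 (g y - x0)) *m invmx (Jx x0))); last first.
    by rewrite -JxE mulmxBl mulmxK ?uJx //= opprB addrC -/x0.
  rewrite normrN; apply: le_trans (hK' _) _.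
  apply: (@le_trans _ _ (K' * (e / (K' * (2 * K)) * (2 * K * `|y - y0|)))).
    rewrite ler_pM2l //; apply: le_trans h _.
    by rewrite ler_pM2l // divr_gt0 // mulr_gt0.
  rewrite le_eqVlt; apply/orP; left; apply/eqP; field.
  by rewrite !gt_eqF.
exists V, g; split; [by []|by move=> x /Vr/rU|exact: ofV|exact: gf|].
split=> [y Vy|v y0 Vy0]; first by have [] := gdiff y Vy.
have [Vx0 fx0] := gV _ Vy0.
have Dg y : (f @` V) y -> 'd f (g y) ('D_v g y) = v.
  move=> Vy; have [Vx fx] := gV _ Vy; have [dg Eg] := gdiff y Vy.
  have -> : 'D_v g y = v *m invmx (Jx (g y)).
    exact: etrans (deriveE v dg) (congr1 (@^~ v) Eg).
  by apply: etrans (esym (JxE _ _)) _; rewrite mulmxKV // uJx.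
(* Continuity of ['D_v g] at [y0] needs no continuity of matrix inversion: ['d f (g y)] sends
   ['D_v g y] to the constant [v] and [w0] to ['D_w0 f (g y)], which tends to [v]; [dinv] converts
   this into closeness of ['D_v g y] and [w0]. *)
pose w0 := 'D_v g y0.
have cw : {for y0, continuous ('D_w0 f \o g)}.
  apply: (@continuous_comp _ _ _ g ('D_w0 f)); first exact: gcont.
  by apply: cf.2; exact/rU/Vr.
apply/continuous_for_normP => e e0.
have e2 : 0 < e / (2 * K) by rewrite divr_gt0.
have := nV y0 Vy0; apply: filter_app.
move/continuous_for_normP : cw => /(_ _ e2); apply: filter_app.
near=> y => /= cw Vy; have [Vx fx] := gV _ Vy.
apply: le_trans (dinv (g y) _ Vx) _; rewrite -ler_pdivlMl // mulrC.
apply: le_trans cw; rewrite linearB /= distrC.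
have -> : 'd f (g y) ('D_v g y) = 'D_w0 f (g y0).
  rewrite Dg // -(Dg y0 Vy0); apply: esym; apply: deriveE.
  exact: cf.1 _ (rU _ (Vr _ Vx0)).
suff -> : 'd f (g y) w0 = 'D_w0 f (g y) by [].
by apply: esym; apply: deriveE; exact: cf.1 _ (rU _ (Vr _ Vx)).
Unshelve. all: by end_near. Qed.

(** * Submanifolds *)

(* [J *m P + L] is the Jacobian of [x |-> G x *m P + x *m L] when [J] is that of
   [G]; coordinates below [k] come from [L] only, the others from [P] only. *)
Lemma straightening_matrices (F : fieldType) (N k r : nat)
    (J : 'M[F]_(N, r.+1)) (x0 : 'rV[F]_r.+1) :
  N = (k + r)%N -> \rank J = r -> ~~ (x0 <= J)%MS ->
  exists (P : 'M[F]_(r.+1, N)) (L : 'M[F]_N),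
    [/\ J *m P + L \in unitmx,
        x0 *m P = 0,
        (forall y : 'rV[F]_r.+1, y *m P = 0 -> (y <= x0)%MS),
        (forall (y : 'rV[F]_r.+1) (i : 'I_N), (i < k)%N -> (y *m P) ord0 i = 0) &
        (forall (x : 'rV[F]_N) (i : 'I_N), (k <= i)%N -> (x *m L) ord0 i = 0)].
Proof.
move=> EN rJ x0J.
have x00 : x0 != 0 by apply: contraNneq x0J => ->; rewrite sub0mx.
pose A := J *m cokermx x0.
(* The row space of [J] meets the line of [x0] trivially, so projecting along [x0] loses no rank. *)
have rA : \rank A = r.
  have := mxrank_mul_ker J (cokermx x0); rewrite rJ -/A.
  suff -> : (J :&: kermx (cokermx x0))%MS = 0 by rewrite mxrank0 addn0.
  apply/eqP/rowV0P => v; rewrite sub_capmx => /andP[vJ /sub_kermxP vx].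
  have /sub_rVP[t vt] : (v <= x0)%MS by rewrite submxE vx.
  apply: contraNeq x0J => v0; move: v0 vJ; rewrite vt scaler_eq0 negb_or.
  by case/andP=> t0 _; rewrite eqmx_scale.
pose C := col_ebase A; pose E := row_ebase A.
have AE : A = C *m pid_mx r *m E.
  by rewrite -[LHS]mulmx_ebase rA.
(* [P1] projects along [x0], passes to coordinates in which the image of [J] occupies the first [r]
   places, and keeps those [r] coordinates. *)
pose P1 : 'M[F]_(r.+1, N) := cokermx x0 *m invmx E *m pid_mx r.
have JP1 : J *m P1 = C *m pid_mx r.
  have -> : J *m P1 = A *m invmx E *m pid_mx r.
    by rewrite /P1 (mulmxA J) (mulmxA J).
  rewrite [X in X *m invmx E]AE mulmxK ?row_ebase_unit //.
  by rewrite -mulmxA pid_mx_id.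
(* [pid_mx r] fills the first [r] columns, whereas the slice condition is on the
   last ones: [W] reverses the order of the columns. *)
pose s : 'S_N := perm (@rev_ord_inj N).
pose W : 'M[F]_N := perm_mx (s^-1)%g.
have WE m (B : 'M[F]_(m, N)) i j : (B *m W) i j = B i (rev_ord j).
  by rewrite /W -col_permE mxE permE.
have x0k : (x0 <= kermx P1)%MS.
  by apply/sub_kermxP; rewrite /P1 (mulmxA x0) (mulmxA x0) mulmx_coker !mul0mx.
have rN : (r <= N)%N by rewrite EN leq_addl.
(* Already [J *m P1] has rank [r], so the kernel of [P1] has dimension at most 1; it contains the
   nonzero [x0]. *)
have ker_P1 : (kermx P1 <= x0)%MS.
  rewrite -(geq_leqif (mxrank_leqif_sup x0k)) mxrank_ker rank_rV x00.
  rewrite leq_subLR addn1 ltnS.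
  have := mxrankM_maxr J P1; rewrite JP1.
  by rewrite eqmxMfull ?row_full_unit ?col_ebase_unit // rank_pid_mx.
(* The two projections [pid_mx r] and [copid_mx r] add up to the identity, so the Jacobian becomes
   the invertible matrix [C *m W]. *)
exists (P1 *m W), (C *m copid_mx r *m W).
have rev_lt (i : 'I_N) : (rev_ord i < r)%N = (k <= i)%N.
  by have := ltn_ord i; move: EN => /=; lia.
split.
- rewrite mulmxA JP1 -mulmxDl -mulmxDr unitmx_mul unitmx_perm andbT.
  by rewrite addrC subrK mulmx1 col_ebase_unit.
- by rewrite mulmxA (sub_kermxP x0k) mul0mx.
- move=> y yP; apply: submx_trans ker_P1; apply/sub_kermxP.
  by apply: (can_inj (mulmxK (unitmx_perm F s^-1%g))); rewrite mul0mx -mulmxA.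
- move=> y i ik; rewrite mulmxA WE mulmxA mxE big1 // => j _.
  rewrite [X in _ * X]mxE.
  have [->|_] := eqVneq (nat_of_ord j) (rev_ord i); last by rewrite mulr0.
  by rewrite rev_lt leqNgt ik mulr0.
- move=> x i ik; rewrite mulmxA WE mulmxA mxE big1 // => j _.
  rewrite [X in _ * X]mxE [X in _ * (X + _)]mxE [X in _ * (_ + X)]mxE.
  rewrite [X in _ * (_ - X)]mxE; case: (eqVneq j (rev_ord i)) => [->|ji].
    by rewrite rev_lt ik eqxx subrr mulr0.
  by rewrite -[_ == _ :> nat]/(j == rev_ord i) (negPf ji) subrr mulr0.
Qed.

(** * Charts composed with local diffeomorphisms, and preimages of lines *)

(** This property passes to product atlases ([prod_C1_atlas]), which lets the construction of slice
    charts run on [M * M]. *)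
Definition C1_atlas (R : realType) (M : topologicalType) (m : nat)
    (A : set (chart R M m)) : Prop :=
  (forall phi, A phi -> is_chart phi) /\
  (forall phi psi, A phi -> A psi -> Ck 1 (overlap phi psi) (transition phi psi)).

Lemma smooth_C1_atlas (R : realType) (M : topologicalType) (m : nat)
    (A : set (chart R M m)) : smooth_manifold A -> C1_atlas A.
Proof. by case=> _ _ ? _ h; split=> // phi psi Aphi Apsi; exact: h. Qed.

Lemma chart_codP (R : realType) (M : topologicalType) (m : nat)
    (phi : chart R M m) x : is_chart phi -> chart_cod phi x ->
  chart_dom phi (chart_inv phi x) /\ phi (chart_inv phi x) = x.
Proof. by case=> _ _ h _ _ [p dp <-]; rewrite h. Qed.

Lemma open_chart_image (R : realType) (M : topologicalType) (m : nat)
    (phi : chart R M m) (W : set M) :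
  is_chart phi -> open W -> open (phi @` (chart_dom phi `&` W)).
Proof.
move=> cphi oW; have [od oc phiK _ ci] := cphi.
rewrite openE => _ [p [dp Wp] <-].
have cp : chart_cod phi (phi p) by exists p.
have n1 : nbhs (phi p) (chart_cod phi) by exact: open_nbhs_nbhs.
have n2 : nbhs (phi p) (chart_inv phi @^-1` W).
  by apply: (ci _ cp); rewrite phiK //; exact: open_nbhs_nbhs.
apply: filterS (filterI n1 n2) => y [cy Wy].
have [dy yK] := chart_codP cphi cy.
by exists (chart_inv phi y).
Qed.

Lemma open_overlap (R : realType) (M : topologicalType) (m : nat)
    (phi psi : chart R M m) :
  is_chart phi -> is_chart psi -> open (overlap phi psi).
Proof. by move=> cphi [od _ _ _ _]; exact: open_chart_image. Qed.

(** Intended for a diffeomorphism [f] from [V] onto its image, with inverse [g]; off these sets [f]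
    and [g] may carry junk values. *)
Definition post_chart (R : realType) (M : Type) (m : nat) (phi : chart R M m)
    (V : set 'rV[R]_m) (f g : 'rV[R]_m -> 'rV[R]_m) : chart R M m :=
  Chart (chart_dom phi `&` [set p | V (phi p)]) (f \o phi) (chart_inv phi \o g).

Lemma post_chart_cod (R : realType) (M : topologicalType) (m : nat)
    (phi : chart R M m) (V : set 'rV[R]_m) (f g : 'rV[R]_m -> 'rV[R]_m) :
  is_chart phi -> V `<=` chart_cod phi ->
  chart_cod (post_chart phi V f g) = f @` V.
Proof.
move=> cphi VU; apply/seteqP; split=> [_ [p [dp Vp] <-]|_ [x Vx <-]].
  by exists (phi p).
have [dx xK] := chart_codP cphi (VU _ Vx).
by exists (chart_inv phi x) => /=; rewrite ?xK.
Qed.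

Lemma post_chart_is_chart (R : realType) (M : topologicalType) (m : nat)
    (phi : chart R M m) (V : set 'rV[R]_m) (f g : 'rV[R]_m -> 'rV[R]_m) :
  is_chart phi -> open V -> V `<=` chart_cod phi -> open (f @` V) ->
  (forall x, V x -> g (f x) = x) ->
  (forall x, V x -> {for x, continuous f}) ->
  (forall x, (f @` V) x -> {for x, continuous g}) ->
  is_chart (post_chart phi V f g).
Proof.
move=> cphi oV VU ofV gf cf cg; have [od oc phiK cphi' ci] := cphi.
split.
- rewrite openE => p [dp Vp].
  have n1 : nbhs p (chart_dom phi) by exact: open_nbhs_nbhs.
  have n2 : nbhs p (phi @^-1` V) by apply: (cphi' p dp); exact: open_nbhs_nbhs.
  exact: filterI n1 n2.
- by rewrite post_chart_cod.
- by move=> p [dp Vp] /=; rewrite gf // phiK.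
- move=> p [dp Vp]; apply: (@continuous_comp _ _ _ phi f).
    exact: cphi'.
  exact: cf.
- rewrite post_chart_cod // => y Vy; apply: (@continuous_comp _ _ _ g (chart_inv phi)).
    exact: cg.
  by case: Vy => x Vx <-; rewrite gf //; apply: ci; exact: VU.
Qed.

(** The transition maps are those between [phi] and [psi], composed with [g] on one side and with
    [f] on the other. *)
Lemma post_chart_C1 (R : realType) (M : topologicalType) (m : nat)
    (A : set (chart R M m)) (phi : chart R M m) (V : set 'rV[R]_m)
    (f g : 'rV[R]_m -> 'rV[R]_m) :
  C1_atlas A -> A phi -> open V -> V `<=` chart_cod phi -> open (f @` V) ->
  (forall x, V x -> g (f x) = x) -> Ck 1 V f -> Ck 1 (f @` V) g ->
  C1_chart A (post_chart phi V f g).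
Proof.
move=> [Ac At] Aphi oV VU ofV gf cf cg; have cphi := Ac _ Aphi.
have [od oc phiK cphi' ci] := cphi.
have cchi : is_chart (post_chart phi V f g).
  apply: post_chart_is_chart => // x Vx.
    exact: Ck1_continuous cf Vx.
  exact: Ck1_continuous cg Vx.
split=> // psi Apsi; have cpsi := Ac _ Apsi; split.
  apply: (@Ck1_comp _ _ _ _ _ (overlap phi psi) g (transition phi psi)).
  - exact: open_overlap.
  - move=> _ [p [[dp Vp] dpsi] <-] /=; rewrite gf //.
    by exists p.
  - apply: Ck1_subset cg => _ [p [[dp Vp] dpsi] <-] /=.
    by exists (phi p).
  - exact: At.
have [_ _ psiK _ _] := cpsi.
apply: (@Ck1_comp _ _ _ _ _ V (transition psi phi) f).
- exact: open_overlap.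
- move=> _ [p [dpsi [dp Vp]] <-] /=; rewrite /transition /= psiK //.
- apply: Ck1_subset (At _ _ Apsi Aphi) => _ [p [dpsi [dp Vp]] <-] /=.
  by exists p.
- exact: cf.
Qed.

(** The rank conditions say that [G] is transverse to the line spanned by [x0]. That line has
    codimension [r] in its ambient space, hence so does its preimage, which leaves dimension [k].
    The slice chart comes from the inverse function theorem applied to [G x *m P + x *m L]. *)
Lemma embedded_C1_preimage_line (R : realType) (M : topologicalType)
    (m k r : nat) (A : set (chart R M m)) (S : set M) :
  C1_atlas A -> m = (k + r)%N ->
  (forall z, S z -> exists (phi : chart R M m) (U : set 'rV[R]_m)
     (G : 'rV[R]_m -> 'rV[R]_r.+1) (J : 'M[R]_(m, r.+1)) (x0 : 'rV[R]_r.+1),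
     [/\ A phi /\ chart_dom phi z,
         [/\ open U, U (phi z) & U `<=` chart_cod phi],
         Ck 1 U G /\ (forall v, 'd G (phi z) v = v *m J),
         \rank J = r /\ ~~ (x0 <= J)%MS &
         forall p, chart_dom phi p -> U (phi p) ->
           (S p <-> (G (phi p) <= x0)%MS)]) ->
  embedded_C1_submanifold A k S.
Proof.
move=> Aat mkr loc z Sz.
have [phi [U [G [J [x0 [[Aphi dz] [oU Uz Uc] [cG dG] [rJ x0J] SG]]]]]] := loc z Sz.
have cphi : is_chart phi by exact: Aat.1.
have [P [L [uJ x0P kerP Pk Lk]]] := straightening_matrices mkr rJ x0J.
pose f x := G x *m P + x *m L.
have cf : Ck 1 U f.
  apply: Ck1_add => //; last exact: (@Ck1_linear R _ m (mulmxr L)).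
  exact: Ck1_mulmxr.
have df v : 'd f (phi z) v = v *m (J *m P + L).
  have dGz : is_diff (phi z) G (mulmxr J).
    by apply: DiffDef; [exact: cG.1|apply/funext => u; exact: dG].
  have dfz : is_diff (phi z) f ((mulmxr P \o mulmxr J) + mulmxr L).
    have dP : is_diff (phi z) (mulmxr P \o G) (mulmxr P \o mulmxr J).
      exact: is_diff_comp dGz (is_diff_linear_rV (mulmxr P) _).
    exact: is_diffD dP (is_diff_linear_rV (mulmxr L) _).
  rewrite (@diff_val _ _ _ _ _ _ _ dfz) /=.
  by rewrite !fctE /= mulmxDr mulmxA.
have [V [g [[oV Vz] VU ofV gf cg]]] := inverse_function oU Uz cf df uJ.
have Vc : V `<=` chart_cod phi by move=> x /VU/Uc.
exists (post_chart phi V f g); split.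
- by apply: post_chart_C1 => //; exact: Ck1_subset VU cf.
- by [].
rewrite post_chart_cod //.
(* From index [k] on, the coordinates of [f] are those of [G x *m P], whose coordinates below [k]
   vanish identically. So the slice condition says [G x *m P = 0], that is, [G x] lies on the line
   of [x0]. *)
have fS p : chart_dom phi p -> V (phi p) ->
    S p <-> forall i : 'I_m, (k <= i)%N -> f (phi p) ord0 i = 0.
  move=> dp Vp; have {}SG := SG p dp (VU _ Vp); split.
    move=> /SG /sub_rVP[t Gt] i ki.
    by rewrite /f mxE Lk // Gt -scalemxAl x0P scaler0 mxE addr0.
  move=> fi; apply/SG/kerP; apply/rowP => i; rewrite [RHS]mxE.
  have [ki|ik] := leqP k i; last exact: Pk.
  by have := fi i ki; rewrite /f mxE Lk // addr0.
apply/seteqP; split=> [_ [p [Sp [dp Vp]] <-]|_ [[x Vx <-] fx]].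
  by split; [exists (phi p)|exact/fS].
have [dx xK] := chart_codP cphi (Vc _ Vx).
exists (chart_inv phi x) => /=; rewrite ?xK //; split=> //.
by apply/fS; rewrite ?xK.
Qed.

(** * Products of charts and quadrics *)

(** Both row spaces have dimension [n] and lie in the hyperplane [kermx w] of dimension [n.+1]. A
    sum of dimension at most [n] would coincide with each of them. *)
Lemma rank_sum_hyperplane (F : fieldType) (n : nat) (B C : 'M[F]_(n, n.+2))
    (w : 'cV[F]_n.+2) :
  w != 0 -> row_free B -> row_free C -> B *m w = 0 -> C *m w = 0 ->
  ~~ (B == C)%MS -> \rank (B + C)%MS = n.+1.
Proof.
move=> w0 /eqP rB /eqP rC /sub_kermxP Bw /sub_kermxP Cw BC.
have le : (\rank (B + C)%MS <= n.+1)%N.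
  apply: leq_trans (mxrankS (_ : (B + C <= kermx w)%MS)) _.
    by rewrite addsmx_sub Bw.
  by rewrite mxrank_ker -mxrank_tr rank_rV trmx_eq0 w0 subSS subn0.
apply/eqP; rewrite eqn_leq le ltnNge; apply: contra BC => ge.
have BD : (B + C <= B)%MS.
  by rewrite -(geq_leqif (mxrank_leqif_sup (addsmxSl B C))) rB.
have CD : (B + C <= C)%MS.
  by rewrite -(geq_leqif (mxrank_leqif_sup (addsmxSr B C))) rC.
by rewrite (submx_trans (addsmxSl _ _) CD) (submx_trans (addsmxSr _ _) BD).
Qed.

Lemma derive_mulmxr (R : realType) (V : normedModType R) p q
    (h : V -> 'rV[R]_p) (B : 'M[R]_(p, q)) u v : differentiable h u ->
  'D_v (fun x => h x *m B) u = 'D_v h u *m B /\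
  differentiable (fun x => h x *m B) u.
Proof.
move=> dh; pose L : {linear 'rV[R]_p -> 'rV[R]_q} := mulmxr B.
have dL := is_diff_linear_rV L (h u).
have dLh : is_diff u (L \o h) (L \o 'd h u).
  by apply: is_diff_comp; exact: differentiableP.
have dd : differentiable (fun x => h x *m B) u by exact: ex_diff.
split=> //; apply: etrans (deriveE v dd) _.
apply: etrans (congr1 (@^~ v) (@diff_val _ _ _ _ _ _ _ dLh)) _.
by rewrite /= (deriveE v dh).
Qed.

Lemma derive_comp_linear (R : realType) (W : normedModType R) p q
    (f : 'rV[R]_q -> W) (l : {linear 'rV[R]_p -> 'rV[R]_q}) a b v :
  l a = b -> differentiable f b ->
  differentiable (f \o l) a /\ 'D_v (f \o l) a = 'd f b (l v).
Proof.
move=> <- df.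
have dl := is_diff_linear_rV l a.
have dfl : is_diff a (f \o l) ('d f (l a) \o l).
  by apply: is_diff_comp; exact: differentiableP.
have dd : differentiable (f \o l) a by exact: ex_diff.
split=> //; apply: etrans (deriveE v dd) _.
exact: (congr1 (@^~ v) (@diff_val _ _ _ _ _ _ _ dfl)).
Qed.

Lemma mulmx_form_sym (F : comPzRingType) d (Q : 'M[F]_d) (x y : 'rV[F]_d) :
  Q^T = Q -> x *m Q *m y^T = y *m Q *m x^T.
Proof.
move=> sQ; transitivity ((x *m Q *m y^T)^T).
  by apply/matrixP => i j; rewrite [RHS]mxE !ord1.
by rewrite trmx_mul trmx_mul trmxK sQ mulmxA.
Qed.

(** Differentiating the constant [h x *m Q *m (h x)^T] by the product rule gives two terms, equal by
    symmetry of [Q]; hence each is zero. *)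
Lemma diff_quadric_orthogonal (R : realType) (V : normedModType R) d
    (Q : 'M[R]_d) (c : R) (h : V -> 'rV[R]_d) u v :
  Q^T = Q -> differentiable h u -> (\forall x \near u, quadric Q c (h x)) ->
  'd h u v *m (Q *m (h u)^T) = 0.
Proof.
move=> sQ dh hQ.
have [DQ dhQ] := derive_mulmxr Q v dh.
pose q x := (h x *m Q *m (h x)^T) ord0 ord0.
have dq0 : 'D_v q u = 0.
  by rewrite (@near_eq_derive _ _ _ q (cst c)) ?derive_cst.
pose t j (x : V) := (h x *m Q) ord0 j * h x ord0 j.
have qE : q = \sum_(j < d) t j.
  apply/funext => x; rewrite /q mxE fct_sumE; apply: eq_bigr => j _.
  by rewrite [_^T _ _]mxE.
have dh1 : derivable h u v by exact: diff_derivable.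
have dhQ1 : derivable (fun x => h x *m Q) u v by exact: diff_derivable.
have dhj j : derivable (fun x => h x ord0 j) u v by move/derivable_mxP : dh1.
have dhQj j : derivable (fun x => (h x *m Q) ord0 j) u v.
  by move/derivable_mxP : dhQ1.
have Ehj j : 'D_v (fun x => h x ord0 j) u = 'D_v h u ord0 j.
  by rewrite (derive_mx dh1) mxE.
have EhQj j : 'D_v (fun x => (h x *m Q) ord0 j) u = ('D_v h u *m Q) ord0 j.
  by rewrite -DQ (derive_mx dhQ1) mxE.
move: dq0; rewrite qE derive_sum; last by move=> j; exact: derivableM.
under eq_bigr => j _ do rewrite deriveM // Ehj EhQj.
rewrite big_split /=.
set w := 'D_v h u => E.
have sumE (x y : 'rV[R]_d) :
    \sum_(i < d) (x *m Q) ord0 i * y ord0 i = (x *m Q *m y^T) ord0 ord0.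
  by rewrite [RHS]mxE; apply: eq_bigr => i _; rewrite [_^T _ _]mxE.
have E2 : (w *m Q *m (h u)^T) ord0 ord0 = 0.
  move: E; rewrite (sumE (h u) w).
  under eq_bigr => j _ do rewrite -[_ *: _]/(_ * _) mulrC.
  rewrite sumE (mulmx_form_sym (h u)) //; lra.
rewrite -(deriveE v dh) -/w mulmxA.
by apply/matrixP => i j; rewrite !ord1 E2 mxE.
Qed.

Lemma Ck1_row_mx (R : realType) (V : normedModType R) p q (U : set V)
    (f : V -> 'rV[R]_p) (g : V -> 'rV[R]_q) :
  open U -> Ck 1 U f -> Ck 1 U g -> Ck 1 U (fun x => row_mx (f x) (g x)).
Proof.
move=> oU cf cg.
apply: (@Ck1_eq_on _ _ _ _ (fun x => f x *m row_mx 1%:M 0 + g x *m row_mx 0 1%:M)) => //.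
  by move=> x _; rewrite !mul_mx_row !mulmx1 !mulmx0 add_row_mx addr0 add0r.
by apply: Ck1_add => //; exact: Ck1_mulmxr.
Qed.

Lemma continuous_row_mx (R : realType) (T : topologicalType) p q
    (f : T -> 'rV[R]_p) (g : T -> 'rV[R]_q) x :
  {for x, continuous f} -> {for x, continuous g} ->
  {for x, continuous (fun y => row_mx (f y) (g y))}.
Proof.
move=> cf cg.
rewrite (_ : (fun _ => _) =
  fun y => f y *m row_mx 1%:M 0 + g y *m row_mx 0 1%:M); last first.
  by apply/funext => y; rewrite !mul_mx_row !mulmx1 !mulmx0 add_row_mx addr0 add0r.
by apply: continuousD; exact: continuous_mulmxr.
Qed.

Lemma open_setX (T S : topologicalType) (A : set T) (B : set S) :
  open A -> open B -> open (A `*` B).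
Proof.
move=> oA oB; rewrite openE => -[x y] [/= Ax By].
by exists (A, B) => //; split; exact: open_nbhs_nbhs.
Qed.

Lemma open_submx_preimage (R : realType) p q (A : set 'rV[R]_p) (B : set 'rV[R]_q) :
  open A -> open B -> open [set x : 'rV[R]_(p + q) | A (lsubmx x) /\ B (rsubmx x)].
Proof.
move=> oA oB; apply: openI.
  apply: (@open_comp _ _ (lsubmx : 'rV[R]_(p + q) -> 'rV[R]_p)) => // x _.
  exact: continuous_lsubmx.
apply: (@open_comp _ _ (rsubmx : 'rV[R]_(p + q) -> 'rV[R]_q)) => // x _.
exact: continuous_rsubmx.
Qed.

Lemma prod_chart_cod (R : realType) (M N : Type) p q
    (phi : chart R M p) (psi : chart R N q) :
  chart_cod (prod_chart phi psi) =
  [set x | chart_cod phi (lsubmx x) /\ chart_cod psi (rsubmx x)].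
Proof.
apply/seteqP; split=> [_ [z [d1 d2] <-]|x /= [[y dy yx] [z dz zx]]].
  by rewrite /= row_mxKl row_mxKr; split; [exists z.1|exists z.2].
by exists (y, z) => //=; rewrite yx zx hsubmxK.
Qed.

Lemma prod_chart_is_chart (R : realType) (M N : topologicalType) p q
    (phi : chart R M p) (psi : chart R N q) :
  is_chart phi -> is_chart psi -> is_chart (prod_chart phi psi).
Proof.
move=> [d1 c1 K1 f1 g1] [d2 c2 K2 f2 g2]; split.
- exact: open_setX.
- by rewrite prod_chart_cod; exact: open_submx_preimage.
- by move=> [x y] [/= dx dy]; rewrite row_mxKl row_mxKr K1 // K2.
- move=> [x y] [/= dx dy]; apply: continuous_row_mx.
    by apply: (@continuous_comp _ _ _ fst phi); [exact: cvg_fst|exact: f1].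
  by apply: (@continuous_comp _ _ _ snd psi); [exact: cvg_snd|exact: f2].
- rewrite prod_chart_cod => x [cx cy].
  pose l : 'rV[R]_(p + q) -> 'rV[R]_p := lsubmx.
  pose r : 'rV[R]_(p + q) -> 'rV[R]_q := rsubmx.
  have h1 : {for x, continuous (chart_inv phi \o l)}.
    apply: continuous_comp; first exact: continuous_lsubmx.
    exact: g1.
  have h2 : {for x, continuous (chart_inv psi \o r)}.
    apply: continuous_comp; first exact: continuous_rsubmx.
    exact: g2.
  exact: cvg_pair h1 h2.
Qed.

(** Transition maps of product charts act separately on the two blocks of coordinates. *)
Lemma prod_C1_atlas (R : realType) (M N : topologicalType) p q
    (A : set (chart R M p)) (B : set (chart R N q)) :
  C1_atlas A -> C1_atlas B -> C1_atlas (prod_atlas A B).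
Proof.
move=> [Ac At] [Bc Bt]; split.
  move=> _ [phi [psi [Aphi Bpsi ->]]].
  by apply: prod_chart_is_chart; [exact: Ac|exact: Bc].
move=> _ _ [f1 [f2 [A1 B2 ->]]] [h1 [h2 [A1' B2' ->]]].
have oO : open (overlap (prod_chart f1 f2) (prod_chart h1 h2)).
  apply: open_overlap; apply: prod_chart_is_chart;
  by [exact: Ac|exact: Bc].
pose l : {linear 'rV[R]_(p + q) -> 'rV[R]_p} := lsubmx.
pose r : {linear 'rV[R]_(p + q) -> 'rV[R]_q} := rsubmx.
apply: (Ck1_row_mx oO).
  apply: (@Ck1_comp _ _ _ _ _ (overlap f1 h1) l (transition f1 h1)) => //.
  - move=> _ [[x y] [[/= d1 d2] [/= e1 e2]] <-]; rewrite /l /= row_mxKl.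
    by exists x.
  - exact: Ck1_linear.
  - exact: At.
apply: (@Ck1_comp _ _ _ _ _ (overlap f2 h2) r (transition f2 h2)) => //.
- move=> _ [[x y] [[/= d1 d2] [/= e1 e2]] <-]; rewrite /r /= row_mxKr.
  by exists y.
- exact: Ck1_linear.
- exact: Bt.
Qed.

(** * Tangent planes read in charts *)

Lemma C1_map_continuous (R : realType) (M : topologicalType) (n d : nat)
    (A : set (chart R M n)) (F : M -> 'rV[R]_d) :
  smooth_manifold A -> C1_map A F -> continuous F.
Proof.
move=> [_ _ Ac cov _] cF p; have [phi Aphi dp] := cov p.
have [od oc phiK cphi ci] := Ac _ Aphi.
have h : {for p, continuous ((F \o chart_inv phi) \o phi)}.
  apply: continuous_comp; first exact: cphi.
  by apply: Ck1_continuous (cF _ Aphi) _; exists p.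
apply: near_eq_continuous h; apply: open_near od dp _ => q dq /=.
by rewrite phiK.
Qed.

(** Near [psi p], reading [F] in [psi] amounts to reading it in [phi] after the transition map, so
    the chain rule applies. The inclusion shows that the union defining [tangent_plane] is the range
    in any single chart. *)
Lemma chart_diff_range_sub (R : realType) (M : topologicalType) (n d : nat)
    (A : set (chart R M n)) (F : M -> 'rV[R]_d) (phi psi : chart R M n) p :
  C1_atlas A -> C1_map A F -> A phi -> A psi ->
  chart_dom phi p -> chart_dom psi p ->
  range (chart_diff F psi p) `<=` range (chart_diff F phi p).
Proof.
move=> [Ac At] cF Aphi Apsi dphi dpsi _ [v _ <-].
have [_ _ phiK _ _] := Ac _ Aphi; have [_ _ psiK _ _] := Ac _ Apsi.
have Op : overlap psi phi (psi p) by exists p.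
have tp : transition psi phi (psi p) = phi p by rewrite /transition /= psiK.
have dt : differentiable (transition psi phi) (psi p).
  exact: (At _ _ Apsi Aphi).1.
have df : differentiable (F \o chart_inv phi) (transition psi phi (psi p)).
  by rewrite tp; apply: (cF _ Aphi).1; exists p.
have dg : differentiable (F \o chart_inv psi) (psi p).
  by apply: (cF _ Apsi).1; exists p.
have dc := differentiable_comp dt df.
exists ('d (transition psi phi) (psi p) v) => //.
rewrite /chart_diff -tp.
transitivity ('d ((F \o chart_inv phi) \o transition psi phi) (psi p) v).
  exact: esym (congr1 (@^~ v) (diff_comp dt df)).
apply: etrans (esym (deriveE v dc)) _.
apply: etrans _ (deriveE v dg).
apply: near_eq_derive.
have oO : open (overlap psi phi).
  by apply: open_overlap; exact: Ac.
apply: open_near oO Op _ => _ [q [dq1 dq2] <-] /=.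
by rewrite /transition /= psiK // phiK.
Qed.

Lemma tangent_planeE (R : realType) (M : topologicalType) (n d : nat)
    (A : set (chart R M n)) (F : M -> 'rV[R]_d) (phi : chart R M n) p :
  C1_atlas A -> C1_map A F -> A phi -> chart_dom phi p ->
  tangent_plane A F p = range (chart_diff F phi p).
Proof.
move=> At cF Aphi dphi; apply/seteqP; split=> [v [psi [Apsi dpsi]]|v rv].
  exact: (chart_diff_range_sub At cF).
by exists phi.
Qed.

Lemma open_off_diagonal (T : topologicalType) :
  hausdorff_space T -> open [set z : T * T | z.1 <> z.2].
Proof.
rewrite open_hausdorff => hT; rewrite openE => -[x y] /= /eqP xy.
have [[A B] /= [xA yB] [oA oB AB]] := hT x y xy.
rewrite !inE in xA yB.
exists (A, B) => /=; first by split; exact: open_nbhs_nbhs.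
move=> [u v] [/= Au Bv] uv; rewrite -uv in Bv.
by have : (A `&` B) u by []; rewrite (eqP AB).
Qed.

(** * Coincidence loci of the immersion up to sign *)

(** Treats both loci at once: [e = 1] gives double points and [e = -1] antipodal pairs. The
    condition [e * e = 1] keeps [e *: F v] on the same quadric. *)
Lemma signed_coincidence_submanifold (R : realType) (n : nat) (n_ge1 : (1 <= n)%N)
    (Q : 'M[R]_(n.+2)) (Q_sym : Q^T = Q) (c : R) (c_neq0 : c != 0)
    (M : topologicalType) (A : set (chart R M n)) (M_smooth : smooth_manifold A)
    (F : M -> 'rV[R]_(n.+2)) (F_quadric : forall p : M, quadric Q c (F p))
    (F_immersion : C1_immersion A F) (e : R) :
  e * e = 1 -> ~ has_parallel_tangent_planes A F ->
  embedded_C1_submanifold (prod_atlas A A) n.-1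
    [set z : M * M | z.1 <> z.2 /\ F z.1 = e *: F z.2].
Proof.
move=> e2 nopar; have At := smooth_C1_atlas M_smooth.
have [cF injF] := F_immersion.
have contF := C1_map_continuous M_smooth cF.
have [hM _ _ cov _] := M_smooth.
have e0 : e != 0.
  by apply/eqP => E; move: e2; rewrite E mul0r => /eqP; rewrite eq_sym oner_eq0.
(* The codimension is [n.+1] in dimension [n + n]; the equality [n + n = n.-1 + n.+1] requires
   [n >= 1]. *)
apply: (@embedded_C1_preimage_line _ _ _ _ n.+1); first exact: prod_C1_atlas.
  by case: n n_ge1 {Q Q_sym A M_smooth F F_quadric F_immersion nopar At cF injF contF cov}
    => // n _; rewrite /= addSnnS.
move=> [p q] [/= pq Fpq].
have [phi Aphi dp] := cov p; have [psi Apsi dq] := cov q.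
have cphi : is_chart phi by exact: At.1.
have cpsi : is_chart psi by exact: At.1.
pose f := F \o chart_inv phi; pose g := F \o chart_inv psi.
have phiK : f (phi p) = F p by case: cphi => _ _ K _ _; rewrite /f /= K.
have psiK : g (psi q) = F q by case: cpsi => _ _ K _ _; rewrite /g /= K.
have df : differentiable f (phi p) by apply: (cF _ Aphi).1; exists p.
have dg : differentiable g (psi q) by apply: (cF _ Apsi).1; exists q.
pose Jf := lin1_mx ('d f (phi p)); pose Jg := lin1_mx ('d g (psi q)).
have JfE v : 'd f (phi p) v = v *m Jf by exact: esym (mul_rV_lin1 _ _).
have JgE v : 'd g (psi q) v = v *m Jg by exact: esym (mul_rV_lin1 _ _).
pose w := Q *m (F p)^T.
have Fpw : F p *m w = c%:M.
  by apply/matrixP => i j; rewrite !ord1 /w mulmxA (F_quadric p) mxE.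
have w0 : w != 0.
  apply: contra_neq c_neq0 => w0; move: Fpw; rewrite w0 mulmx0.
  by move/matrixP/(_ ord0 ord0); rewrite !mxE.
have Fqe : F q = e *: F p by rewrite Fpq scalerA e2 scale1r.
have Jfw : Jf *m w = 0.
  apply/row_matrixP => i; rewrite row_mul row0 rowE.
  rewrite -JfE /w -phiK; apply: (@diff_quadric_orthogonal _ _ _ Q c) => //.
  near=> x; exact: F_quadric.
(* Orthogonality at [q] is to [Q *m (F q)^T], which is [e] times [w]. *)
have Jgw : Jg *m w = 0.
  have : Jg *m (Q *m (F q)^T) = 0.
    apply/row_matrixP => i; rewrite row_mul row0 rowE.
    rewrite -JgE -psiK; apply: (@diff_quadric_orthogonal _ _ _ Q c) => //.
    near=> x; exact: F_quadric.
  rewrite Fqe linearZ /= -!scalemxAr => /eqP; rewrite scaler_eq0 (negPf e0) /=.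
  by move/eqP.
have freef : row_free Jf.
  rewrite -kermx_eq0; apply/eqP/row_matrixP => i; rewrite row0.
  apply: (injF phi p Aphi dp); rewrite /chart_diff.
  apply: etrans (JfE _) _; apply: etrans _ (esym (JfE _)).
  by rewrite -row_mul mulmx_ker row0 mul0mx.
have freeg : row_free Jg.
  rewrite -kermx_eq0; apply/eqP/row_matrixP => i; rewrite row0.
  apply: (injF psi q Apsi dq); rewrite /chart_diff.
  apply: etrans (JgE _) _; apply: etrans _ (esym (JgE _)).
  by rewrite -row_mul mulmx_ker row0 mul0mx.
have neqJ : ~~ (Jf == Jg)%MS.
  apply/negP => /eqmxP eqJ; apply: nopar; exists p, q; split; first exact: pq.
  rewrite (tangent_planeE At cF Aphi dp) (tangent_planeE At cF Apsi dq).
  apply/seteqP; split=> _ [v _ <-].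
    have /submxP[u Eu] : (v *m Jf <= Jg)%MS by rewrite -eqJ submxMl.
    exists u; first exact: I.
    apply: etrans (JgE _) _; apply: etrans _ (esym (JfE _)).
    exact: esym Eu.
  have /submxP[u Eu] : (v *m Jg <= Jf)%MS by rewrite eqJ submxMl.
  exists u; first exact: I.
  apply: etrans (JfE _) _; apply: etrans _ (esym (JgE _)).
  exact: esym Eu.
(* On [W] the sum [F u + e F v] is not orthogonal to [w]; at [(p, q)] the pairing equals [2c].
   Removing the diagonal makes the condition [z.1 <> z.2] automatic near [(p, q)]. *)
pose W := [set z : M * M | z.1 <> z.2] `&`
  [set z | ((F z.1 + e *: F z.2) *m w) ord0 ord0 != 0].
have oW : open W.
  apply: openI; first exact: open_off_diagonal.
  apply: (@open_comp _ _ (fun z : M * M => ((F z.1 + e *: F z.2) *m w) ord0 ord0)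
    [set x | x != 0]); last exact: open_neq.
  move=> z _.
  apply: (@continuous_comp _ _ _ (fun z : M * M => (F z.1 + e *: F z.2) *m w)
    (fun x : 'rV[R]_1 => x ord0 ord0)); last exact: coord_continuous.
  apply: continuous_mulmxr; apply: continuousD.
    by apply: (@continuous_comp _ _ _ fst F); [exact: cvg_fst|exact: contF].
  apply: continuousZ; first exact: cst_continuous.
  by apply: (@continuous_comp _ _ _ snd F); [exact: cvg_snd|exact: contF].
(* A difference of two squares, each equal to [c]; the cross terms cancel by symmetry of [Q]. *)
have form_diff (z : M * M) :
    (F z.1 + e *: F z.2) *m Q *m (F z.1 - e *: F z.2)^T = 0.
  rewrite linearB /= mulmxBr !mulmxDl linearZ /=.
  rewrite -!scalemxAl -!scalemxAr scalerA e2 scale1r.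
  rewrite (mulmx_form_sym (F z.2)) //.
  have EF x : F x *m Q *m (F x)^T = c%:M.
    by apply/matrixP => i j; rewrite !ord1 (F_quadric x) mxE.
  by rewrite !EF [X in _ - X]addrC subrr.
pose chi := prod_chart phi psi.
have cchi : is_chart chi by exact: prod_chart_is_chart.
pose U := chi @` (chart_dom chi `&` W).
pose l : {linear 'rV[R]_(n + n) -> 'rV[R]_n} := lsubmx.
pose r : {linear 'rV[R]_(n + n) -> 'rV[R]_n} := rsubmx.
pose G (x : 'rV[R]_(n + n)) := f (l x) + g (r x) *m (- e)%:M.
have GE z : chart_dom chi z -> G (chi z) = F z.1 - e *: F z.2.
  case: z => x y [/= dx dy]; rewrite /G /l /r /= row_mxKl row_mxKr /f /g /=.
  have [_ _ K1 _ _] := cphi; have [_ _ K2 _ _] := cpsi.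
  by rewrite K1 // K2 // mul_mx_scalar scaleNr.
have oU : open U by exact: open_chart_image.
have cG : Ck 1 U G.
  apply: Ck1_add => //; last apply: Ck1_mulmxr => //.
    apply: (@Ck1_comp _ _ _ _ _ (chart_cod phi) l f) => //; last exact: cF.
      by move=> _ [[x y] [[/= dx dy] _] <-]; rewrite /l /= row_mxKl; exists x.
    exact: Ck1_linear.
  apply: (@Ck1_comp _ _ _ _ _ (chart_cod psi) r g) => //; last exact: cF.
    by move=> _ [[x y] [[/= dx dy] _] <-]; rewrite /r /= row_mxKr; exists y.
  exact: Ck1_linear.
have dG v : 'd G (chi (p, q)) v = v *m col_mx Jf (- e *: Jg).
  have la : l (chi (p, q)) = phi p by rewrite /l /= row_mxKl.
  have ra : r (chi (p, q)) = psi q by rewrite /r /= row_mxKr.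
  have [dl Dl] := derive_comp_linear v la df.
  have [dr Dr0] := derive_comp_linear v ra dg.
  have [Dr dr'] := derive_mulmxr (- e)%:M v dr.
  have dG : differentiable G (chi (p, q)) by exact: differentiableD dl dr'.
  apply: etrans (esym (deriveE v dG)) _.
  have -> : 'D_v G (chi (p, q)) =
      'D_v (f \o l) (chi (p, q)) + 'D_v (g \o r) (chi (p, q)) *m (- e)%:M.
    by rewrite -Dr; apply: deriveD; exact: diff_derivable.
  have -> : 'D_v (f \o l) (chi (p, q)) = lsubmx v *m Jf.
    exact: etrans Dl (JfE _).
  have -> : 'D_v (g \o r) (chi (p, q)) = rsubmx v *m Jg.
    exact: etrans Dr0 (JgE _).
  by rewrite -[v in RHS]hsubmxK mul_row_col mul_mx_scalar -scalemxAr.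
exists chi, U, G, (col_mx Jf (- e *: Jg)), (F p); split.
- by split; [exists phi, psi|].
- split; [exact: open_chart_image| |by move=> _ [z [dz _] <-]; exists z].
  exists (p, q) => //; split; first by [].
  split; first exact: pq.
  rewrite /= -Fpq mulmxDl Fpw !mxE /= -mulr2n mulrn_eq0 /=.
  exact: c_neq0.
- by split; [exact: cG|exact: dG].
- split.
    have ne0 : - e != 0 by rewrite oppr_eq0.
    rewrite -addsmxE (adds_eqmx (eqmx_refl Jf) (eqmx_scale Jg ne0)).
    exact: rank_sum_hyperplane w0 freef freeg Jfw Jgw neqJ.
  (* Both blocks of the Jacobian annihilate [w], whereas [F p *m w] is [c], which is nonzero. *)
  apply/negP => /submxP[v Ev]; move: Fpw.
  rewrite Ev -mulmxA mul_col_mx Jfw -scalemxAl Jgw scaler0 col_mx0 mulmx0.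
  by move/matrixP/(_ ord0 ord0)/eqP; rewrite !mxE eq_sym mulr1n (negPf c_neq0).
move=> z dz [z' [dz' [pq' Wz']] Ez].
have zz' : z' = z.
  by have [_ _ K _ _] := cchi; rewrite -(K z) // -(K z') // Ez.
rewrite zz' /= in pq' Wz'; rewrite GE //; split.
  by move=> [_ ->]; rewrite subrr sub0mx.
(* If the difference is [t] times [F p], then [form_diff] makes [t] times the pairing with [w]
   vanish; that pairing is nonzero on [W], so [t = 0]. *)
move=> /sub_rVP[t Et]; split => //; apply/eqP; rewrite -subr_eq0 Et.
have := form_diff z; rewrite Et linearZ /= -scalemxAr -mulmxA -/w => /eqP.
rewrite scaler_eq0 => /orP[/eqP->|/eqP E]; first by rewrite scale0r.
by move: Wz'; rewrite E mxE eqxx.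
Unshelve. all: by end_near. Qed.

Theorem lemma2p1 (R : realType) (n : nat) (n_ge1 : (1 <= n)%N)
    (Q : 'M[R]_(n.+2)) (Q_sym : Q^T = Q) (Q_nonsingular : Q \in unitmx)
    (c : R) (c_neq0 : c != 0)
    (M : topologicalType) (A : set (chart R M n))
    (M_smooth : smooth_manifold A) (M_compact : compact [set: M])
    (F : M -> 'rV[R]_(n.+2))
    (F_quadric : forall p : M, quadric Q c (F p))
    (F_immersion : C1_immersion A F) :
  DA_regular A F \/ has_parallel_tangent_planes A F.
Proof.
have [par|nopar] := pselect (has_parallel_tangent_planes A F); first by right.
left; split.
  rewrite (_ : double_point_locus F =
      [set z : M * M | z.1 <> z.2 /\ F z.1 = 1 *: F z.2]).
    by apply: (@signed_coincidence_submanifold _ _ _ Q _ c); rewrite ?mulr1.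
  by apply/seteqP; split=> z; rewrite /double_point_locus /= scale1r.
rewrite (_ : antipodal_locus F =
    [set z : M * M | z.1 <> z.2 /\ F z.1 = -1 *: F z.2]).
  by apply: (@signed_coincidence_submanifold _ _ _ Q _ c); rewrite ?mulrNN ?mulr1.
apply/seteqP; split=> z; rewrite /antipodal_locus /= scaleN1r; last by case.
(* An antipodal pair cannot lie on the diagonal: [F p = - F p] would give [F p = 0], which is not on
   the quadric because [c] is nonzero. *)
move=> Fz; split=> // z12.
have F0 : F z.2 = 0.
  have : F z.2 + F z.2 = 0 by rewrite -{1}z12 Fz addNr.
  by rewrite -mulr2n -scaler_nat => /eqP; rewrite scaler_eq0 pnatr_eq0 => /eqP.
by move: (F_quadric z.2) c_neq0; rewrite /quadric /= F0 !mul0mx mxE => <-; rewrite eqxx.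
Qed.
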